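(* Let $X$ be a metric space and let $G$ be a topological subgroup of $\mathrm{Iso}(X)$. Then $G$ is skew-amenable if and only if, for every $n \in \mathbb{N}$ and every $x \in X^{n}$, there exists a $G$-invariant mean on $\mathrm{UCB}(Gx)$.
   Context: For a topological group $G$ and $g\in G$ let $\lambda_g\colon G\to G,\ x\mapsto gx$. Let $\mathrm{LUCB}(G)$ be the algebra of all bounded functions $f\colon G\to\mathbb{R}$ that are left-uniformly continuous, i.e., for every $\epsilon>0$ there is a neighborhood $U$ of the neutral element with $|f(x)-f(y)|\le\epsilon$ whenever $x,y \in G$ and $x^{-1}y\in U$. A mean on a linear subspace $A\subseteq\ell^\infty(Z)$ containing the constant function $\mathbf 1$ ($Z$ a set, $\ell^\infty(Z)$ the bounded real-valued functions) is a positive linear functional $\mu\colon A\to\mathbb{R}$ with $\mu(\mathbf 1)=1$. The group $G$ is skew-amenable if $\mathrm{LUCB}(G)$ admits a left-invariant mean, i.e., a mean $\mu$ with $\mu(f\circ\lambda_g)=\mu(f)$ for all $f\in\mathrm{LUCB}(G)$, $g\in G$. $\mathrm{Iso}(X)$ is the group of all isometries (bijective) of the metric space $X$, with the topology of pointwise convergence with respect to the metric; a topological subgroup is a subgroup with the subspace topology. $G$ acts on $X^n$ coordinatewise, $g(x_0,\ldots,x_{n-1})=(gx_0,\ldots,gx_{n-1})$, and $Gx=\{gx\mid g\in G\}\subseteq X^n$ carries the uniformity inherited from the product uniformity on $X^n$ (equivalently, given by the maximum metric). For a uniform space $Y$, $\mathrm{UCB}(Y)$ is the algebra of bounded uniformly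 continuous real-valued functions on $Y$. A mean $\mu$ on $\mathrm{UCB}(Gx)$ is $G$-invariant if $\mu(f\circ\alpha_g)=\mu(f)$ for all $f\in\mathrm{UCB}(Gx)$ and $g\in G$, where $\alpha_g(y)=gy$. *)

(* Defs.v *)
From HB Require Import structures.
From mathcomp Require Import all_boot all_order all_algebra finmap.
From mathcomp Require Import all_classical all_reals all_analysis.

Set Implicit Arguments.
Unset Strict Implicit.
Unset Printing Implicit Defensive.

Import Order.TTheory GRing.Theory Num.Theory.
Import numFieldNormedType.Exports.

Local Open Scope classical_set_scope.
Local Open Scope ring_scope.

HB.mixin Record isTopologicalGroup G & Group G & Topological G := {
  mulg_continuous : continuous (fun p : G * G => (p.1 * p.2)%g) ;
  invg_continuous : continuous (fun x : G => (x^-1)%g)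
}.

#[short(type="topologicalGroupType")]
HB.structure Definition TopologicalGroup :=
  { G of Group G & Topological G & isTopologicalGroup G }.

Section Means.
Context {R : realType}.

(* A is thought of as a linear subspace of the bounded functions on Z that
   contains the constants.  A functional on A is represented by a total map on
   Z -> R of which only the values on A are constrained or used. *)
Definition mean (Z : Type) (A : set (Z -> R)) (mu : (Z -> R) -> R) : Prop :=
  [/\ forall (a : R) (f g : Z -> R), A f -> A g ->
        mu (fun z => a * f z + g z) = a * mu f + mu g,
      forall f : Z -> R, A f -> (forall z, 0 <= f z) -> 0 <= mu f &
      mu (fun=> 1) = 1].

Definition bounded_subspace (Z : Type) (A : set (Z -> R)) : Prop :=
  [/\ forall f, A f -> bounded_fun f,
      forall (a : R) (f g : Z -> R), A f -> A g ->
        A (fun z => a * f z + g z) &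
      A (fun=> 1)].

Definition UCB (Y : uniformType) : set (Y -> R) :=
  [set f | bounded_fun f /\ unif_continuous f].

Definition LUCB (G : topologicalGroupType) : set (G -> R) :=
  [set f | bounded_fun f /\
     forall eps : R, 0 < eps -> exists2 U : set G, nbhs (1%g : G) U &
       forall x y : G, U (x^-1 * y)%g -> `|f x - f y| <= eps].

Definition left_invariant (G : topologicalGroupType)
    (mu : (G -> R) -> R) : Prop :=
  forall (f : G -> R) (g : G), LUCB f -> mu (fun x => f (g * x)%g) = mu f.

End Means.

Arguments UCB R Y : clear implicits.
Arguments LUCB R G : clear implicits.

Definition skew_amenable (R : realType) (G : topologicalGroupType) : Prop :=
  exists mu : (G -> R) -> R, mean (LUCB R G) mu /\ left_invariant mu.

Section BoundedSubspaces.
Context {R : realType}.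

Lemma bounded_funP (Z : Type) (f : Z -> R) :
  bounded_fun f <-> exists M : R, forall z, `|f z| <= M.
Proof.
split=> [[M [_ fM]]|[M fM]].
  by exists (M + 1) => z; apply: fM; rewrite ?ltrDl.
exists M; split; first exact: num_real.
by move=> N MN z _; exact/(le_trans (fM z))/ltW.
Qed.

Lemma bounded_lincomb (Z : Type) (a : R) (f g : Z -> R) :
  bounded_fun f -> bounded_fun g -> bounded_fun (fun z => a * f z + g z).
Proof.
move=> /bounded_funP[M fM] /bounded_funP[N gN]; apply/bounded_funP.
exists (`|a| * M + N) => z; rewrite (le_trans (ler_normD _ _))// lerD//.
by rewrite normrM ler_wpM2l.
Qed.

Lemma bounded_fun1 (Z : Type) : bounded_fun (fun _ : Z => 1 : R).
Proof. by apply/bounded_funP; exists 1 => z; rewrite normr1. Qed.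

Lemma UCB_subspace (Y : uniformType) : bounded_subspace (UCB R Y).
Proof.
split=> [f []//|a f g [bf uf] [bg ug]|].
  split; first exact: bounded_lincomb.
  move=> E; rewrite -entourage_ballE => -[e /= e0 eE].
  pose d := e / 2 / (`|a| + 1).
  have a1 : 0 < `|a| + 1 by rewrite ltr_pwDr.
  have d0 : 0 < d by rewrite !divr_gt0.
  have e20 : 0 < e / 2 by rewrite divr_gt0.
  have {}uf : \forall xy \near entourage, ball (f xy.1) d (f xy.2).
    exact: uf _ (entourage_ball _ (PosNum d0)).
  have {}ug : \forall xy \near entourage, ball (g xy.1) (e / 2) (g xy.2).
    exact: ug _ (entourage_ball _ (PosNum e20)).
  apply: (@filterS2 _ (@entourage Y) _ _ _ _ _ uf ug) => -[y z] /=.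
  rewrite /ball/= => fyz gyz; apply: eE => /=; rewrite /ball/=.
  rewrite opprD addrACA -mulrBr (splitr e).
  rewrite (le_lt_trans (ler_normD _ _))// ler_ltD// normrM.
  rewrite (@le_trans _ _ ((`|a| + 1) * d))//.
    by apply: ler_pM => //; [rewrite lerDl|exact: ltW].
  by rewrite /d mulrCA divff ?mulr1// gt_eqF.
split; first exact: bounded_fun1.
move=> E entE; apply: (@filterS _ (@entourage Y) _ setT); last exact: filterT.
by move=> -[y z] _ /=; exact: entourage_refl.
Qed.

Lemma LUCB_subspace (G : topologicalGroupType) : bounded_subspace (LUCB R G).
Proof.
split=> [f []//|a f g [bf uf] [bg ug]|].
  split; first exact: bounded_lincomb.
  move=> e e0; have a1 : 0 < `|a| + 1 by rewrite ltr_pwDr.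
  have d0 : 0 < e / 2 / (`|a| + 1) by rewrite !divr_gt0.
  have [U U1 fU] := uf _ d0.
  have [V V1 gV] : exists2 V : set G, nbhs (1%g : G) V & forall x y : G,
      V (x^-1 * y)%g -> `|g x - g y| <= e / 2 by apply: ug; rewrite divr_gt0.
  exists (U `&` V); first exact: filterI.
  move=> x y [/fU fxy /gV gxy].
  rewrite opprD addrACA -mulrBr (splitr e).
  rewrite (le_trans (ler_normD _ _))// lerD// normrM.
  rewrite (@le_trans _ _ ((`|a| + 1) * (e / 2 / (`|a| + 1))))//.
    by apply: ler_pM => //; rewrite lerDl.
  by rewrite mulrCA divff ?mulr1// gt_eqF.
split; first exact: bounded_fun1.
move=> e e0; exists setT; first exact: filterT.
by move=> x y _; rewrite subrr normr0 ltW.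
Qed.

Lemma LUCB_lmul (G : topologicalGroupType) (f : G -> R) (g : G) :
  LUCB R G f -> LUCB R G (fun x => f (g * x)%g).
Proof.
move=> [/bounded_funP[M fM] uf]; split.
  by apply/bounded_funP; exists M => z; exact: fM.
move=> e /uf[U U1 fU]; exists U => // x y Uxy; apply: fU.
by rewrite invgM -mulgA mulKg.
Qed.

End BoundedSubspaces.

Section Isometries.
Context {R : realType} (X : metricType R).

Definition is_isometry (f : X -> X) : Prop :=
  bijective f /\ forall x y : X, mdist (f x) (f y) = mdist x y.

Record Iso : Type :=
  MkIso { Iso_fun :> X -> X ; _ : `[< is_isometry Iso_fun >] }.

HB.instance Definition _ := [isSub for Iso_fun].
HB.instance Definition _ := [Choice of Iso by <:].

Lemma IsoP (f : Iso) : is_isometry f.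
Proof. by case: f => f /= /asboolP. Qed.

Lemma Iso_ext (f g : Iso) : f =1 g -> f = g.
Proof. by move=> fg; apply: val_inj; apply/funext. Qed.

Definition Iso_of (f : X -> X) (fP : is_isometry f) : Iso :=
  MkIso (asboolT fP).

Fact Iso_id_subproof : is_isometry id.
Proof. by split=> //; exists id. Qed.

Fact Iso_comp_subproof (f g : Iso) : is_isometry (f \o g).
Proof.
have [[bf df] [bg dg]] := (IsoP f, IsoP g).
by split=> [|x y]; [exact: bij_comp|rewrite /= df dg].
Qed.

Fact Iso_inv_ex (f : Iso) : exists h, cancel f h /\ cancel h f.
Proof. by have [[h fK hK] _] := IsoP f; exists h. Qed.

Definition Iso_inv_fun (f : Iso) : X -> X :=
  sval (cid (Iso_inv_ex f)).

Lemma Iso_funK (f : Iso) : cancel f (Iso_inv_fun f).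
Proof. by rewrite /Iso_inv_fun; case: cid => h []. Qed.

Lemma Iso_inv_funK (f : Iso) : cancel (Iso_inv_fun f) f.
Proof. by rewrite /Iso_inv_fun; case: cid => h []. Qed.

Fact Iso_inv_subproof (f : Iso) : is_isometry (Iso_inv_fun f).
Proof.
have [_ df] := IsoP f; split=> [|x y].
  by exists f; [exact: Iso_inv_funK|exact: Iso_funK].
by rewrite -df !Iso_inv_funK.
Qed.

Definition Iso_one := Iso_of Iso_id_subproof.
Definition Iso_mul f g := Iso_of (Iso_comp_subproof f g).
Definition Iso_inv f := Iso_of (Iso_inv_subproof f).

Fact Iso_mulA : associative Iso_mul.
Proof. by move=> f g h; exact: Iso_ext. Qed.
Fact Iso_mul1 : left_id Iso_one Iso_mul.
Proof. by move=> f; exact: Iso_ext. Qed.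
Fact Iso_mulr1 : right_id Iso_one Iso_mul.
Proof. by move=> f; exact: Iso_ext. Qed.
Fact Iso_mulV : left_inverse Iso_one Iso_inv Iso_mul.
Proof. by move=> f; apply: Iso_ext => x; exact: Iso_funK. Qed.
Fact Iso_mulrV : right_inverse Iso_one Iso_inv Iso_mul.
Proof. by move=> f; apply: Iso_ext => x; exact: Iso_inv_funK. Qed.

HB.instance Definition _ := isGroup.Build Iso Iso_mulA
  Iso_mul1 Iso_mulr1 Iso_mulV Iso_mulrV.

Definition Iso_ptws (f : Iso) : {ptws X -> X} := f.

HB.instance Definition _ :=
  Topological.copy Iso (initial_topology Iso_ptws).

Lemma Iso_eval_continuous (x : X) : continuous (fun f : Iso => f x).
Proof.
move=> f; apply: (@continuous_comp Iso {ptws X -> X} X Iso_ptws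
  (fun h => h x)); first exact: initial_continuous.
exact: (@proj_continuous X (fun=> X) x).
Qed.

Lemma Iso_cvg (F : set_system Iso) (f : Iso) : Filter F ->
  (forall x, (g x : X) @[g --> F] --> f x) -> F --> f.
Proof.
move=> FF Ff U [_ [[W oW <-] Wf WU]]; apply: filterS WU _.
have : Iso_ptws @ F --> Iso_ptws f.
  apply/cvg_sup => x V [_ [[A oA <-] /= Afx AV]].
  apply: filterS AV _; apply: (Ff x); exact: open_nbhs_nbhs.
by apply; exact: open_nbhs_nbhs.
Qed.

Fact Iso_mul_continuous :
  continuous (fun p : Iso * Iso => (p.1 * p.2)%g).
Proof.
move=> [f g]; apply: Iso_cvg => x /=.
apply/metricType_numDomainType.cvgrPdist_lt => e e0.
have e20 : 0 < e / 2 by rewrite divr_gt0.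
have /metricType_numDomainType.cvgrPdist_lt/(_ _ e20) hf :=
  @Iso_eval_continuous (g x) f.
have /metricType_numDomainType.cvgrPdist_lt/(_ _ e20) hg :=
  @Iso_eval_continuous x g.
exists ([set h : Iso | mdist (f (g x)) (h (g x)) < e / 2],
        [set h : Iso | mdist (g x) (h x) < e / 2]); first by split.
move=> [h k] [/= hfg kg].
have [_ dh] := IsoP h.
rewrite (le_lt_trans (metric_triangle _ (h (g x)) _))// (splitr e) ltrD//.
by rewrite dh.
Qed.

Fact Iso_inv_continuous : continuous (fun f : Iso => (f^-1)%g).
Proof.
move=> f; have Ff : Filter (nbhs f) by exact: nbhs_filter.
apply: Iso_cvg => x /=.
apply/metricType_numDomainType.cvgrPdist_lt => e e0.
pose y := (f^-1)%g x.
have fy : f y = x by exact: Iso_inv_funK.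
have /metricType_numDomainType.cvgrPdist_lt/(_ _ e0) :=
  @Iso_eval_continuous y f.
apply: filterS => h /=; rewrite fy => xhy.
have [_ dh] := IsoP h.
by rewrite -dh metric_sym [X in mdist X _]Iso_inv_funK.
Qed.

HB.instance Definition _ := isTopologicalGroup.Build Iso
  Iso_mul_continuous Iso_inv_continuous.

End Isometries.

Section Subgroups.
Context {T : topologicalGroupType} (S : groupClosed T).

Definition subgroup : Type := {x : T | x \in S}.

HB.instance Definition _ := SubChoice.on subgroup.

Fact subgroup_closed : group_closed S.
Proof.
by split=> [|x y xS yS]; [exact: gpred1|apply: gpredM => //; exact: gpredVr].
Qed.

HB.instance Definition _ :=
  SubChoice_isSubGroup.Build T (mem S) subgroup subgroup_closed.
HB.instance Definition _ :=
  Topological.copy subgroup (initial_topology (\val : subgroup -> T)).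

Fact subgroup_mul_continuous :
  continuous (fun p : subgroup * subgroup => (p.1 * p.2)%g).
Proof.
apply: (@continuous_comp_initial _ _ _ (\val : subgroup -> T)) => -[x y].
apply: (@continuous_comp _ (T * T)%type _
  (fun p : subgroup * subgroup => (\val p.1, \val p.2))
  (fun p : T * T => (p.1 * p.2)%g)); last exact: mulg_continuous.
have cval (z : subgroup) : (\val : subgroup -> T) @ nbhs z --> nbhs (\val z).
  exact: initial_continuous.
by apply: cvg_pair => /=; [apply: cvg_comp (cval x); exact: cvg_fst
                          |apply: cvg_comp (cval y); exact: cvg_snd].
Qed.

Fact subgroup_inv_continuous : continuous (fun x : subgroup => (x^-1)%g).
Proof.
apply: (@continuous_comp_initial _ _ _ (\val : subgroup -> T)) => x.
apply: (@continuous_comp subgroup T T \val (fun y => (y^-1)%g)).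
  exact: initial_continuous.
exact: invg_continuous.
Qed.

HB.instance Definition _ := isTopologicalGroup.Build subgroup
  subgroup_mul_continuous subgroup_inv_continuous.

End Subgroups.

Section ProductUniformity.
Context {R : realType} {X : metricType R} {n : nat}.
Implicit Types E : set ({ptws 'I_n -> X} * {ptws 'I_n -> X}).

Lemma entourage_mdist (A : set (X * X)) : entourage A <->
  exists2 e : R, 0 < e & forall y z, mdist y z < e -> A (y, z).
Proof.
rewrite -entourage_ballE; split=> -[e /= e0 eA]; exists e => //.
  by move=> y z yz; apply: eA; rewrite /= ballEmdist.
by move=> -[y z]; rewrite /= ballEmdist => /eA.
Qed.

Lemma ptws_entourageP E : entourage E <->
  exists2 e : R, 0 < e & forall y z : {ptws 'I_n -> X},
    (forall i, mdist (y i) (z i) < e) -> E (y, z).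
Proof.
split.
  move=> [W [F _ <-] FE].
  have : \forall e \near (0:R)^'+, forall y z : {ptws 'I_n -> X},
      (forall i, mdist (y i) (z i) < e) ->
      (\bigcap_(p in [set` F]) (projT1 p).2) (y, z).
    have : \forall e \near (0:R)^'+, (\bigcap_(p in [set` F])
        [set e | forall y z : {ptws 'I_n -> X},
          (forall i, mdist (y i) (z i) < e) -> (projT1 p).2 (y, z)]) e.
      apply: filter_bigI => -[[i A] /= Ai] _.
      have /asboolP [C /entourage_mdist[e e0 eC] CA] := Ai.
      near=> d => y z yz; apply: CA => /=; apply: eC.
      by rewrite (lt_trans (yz i)).
    by apply: filterS => e eF y z yz p pF; exact: eF.
  move=> /(filterI (nbhs_right_gt (0 : R)))/filter_ex[e [e0 eF]].
  by exists e => // y z yz; apply: FE; exact: eF.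
move=> [e e0 eE].
have entI i : @entourage {ptws 'I_n -> X}
    [set yz | mdist (yz.1 i) (yz.2 i) < e].
  set D := [set yz : {ptws 'I_n -> X} * {ptws 'I_n -> X} | _].
  have entD : @entourage (initial_topology (@proj 'I_n (fun=> X) i)) D.
    exists [set yz : X * X | mdist yz.1 yz.2 < e] => //.
    by apply/entourage_mdist; exists e.
  exists D => //.
  exact: (@finI_from1 _ _ _ _
    (exist _ ((i : {classic 'I_n}), D) (asboolT entD))).
apply: (@filterS _ (@entourage {ptws 'I_n -> X}) _ _ _ _
  (@filter_forall _ _ _ (@entourage {ptws 'I_n -> X}) _ entI)) => -[y z] yz.
by apply: eE => i; exact: yz.
Unshelve. all: by end_near. Qed.

End ProductUniformity.

Section Orbits.
Context {R : realType} {X : metricType R} (G : groupClosed (Iso X)).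
Context {n : nat}.

Definition coord_act (g : subgroup G) (x : {ptws 'I_n -> X}) :
  {ptws 'I_n -> X} := fun i => \val g (x i).

Lemma coord_act1 x : coord_act 1%g x = x.
Proof. by apply/funext. Qed.

Lemma coord_actM g h x : coord_act (g * h)%g x = coord_act g (coord_act h x).
Proof. by apply/funext. Qed.

Definition Gorbit (x : {ptws 'I_n -> X}) : set {ptws 'I_n -> X} :=
  [set coord_act g x | g in [set: subgroup G]].

Context (x : {ptws 'I_n -> X}).

Fact Gorbit_act_subproof (g : subgroup G) (y : Gorbit x) :
  coord_act g (\val y) \in Gorbit x.
Proof.
by case: y => y /= /set_mem[h _ <-]; apply/mem_set; exists (g * h)%g.
Qed.

Definition Gorbit_act (g : subgroup G) (y : Gorbit x) : Gorbit x :=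
  exist _ (coord_act g (\val y)) (Gorbit_act_subproof g y).

(* The uniformity on the type of elements of [Gorbit x] is the library's: the
   initial one along the inclusion into the product uniform space. *)
Lemma UCB_orbitP (f : Gorbit x -> R) : UCB R (Gorbit x) f <->
  bounded_fun f /\ forall eps : R, 0 < eps ->
    exists2 d : R, 0 < d & forall y z : Gorbit x,
      (forall i, mdist (\val y i) (\val z i) < d) -> `|f y - f z| < eps.
Proof.
split=> -[bf uf]; split=> //.
  move=> e e0; have [A /ptws_entourageP[d d0 dA] AE] :=
    uf _ (entourage_ball _ (PosNum e0)).
  by exists d => // y z /dA yz; exact: (AE (y, z)).
move=> E; rewrite -entourage_ballE => -[e /= /uf[d d0 df] eE].
exists [set yz : {ptws 'I_n -> X} * {ptws 'I_n -> X} |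
  forall i, mdist (yz.1 i) (yz.2 i) < d].
  by apply/ptws_entourageP; exists d.
by move=> [y z] /df yz; exact: eE.
Qed.

Lemma UCB_act (f : Gorbit x -> R) (g : subgroup G) :
  UCB R (Gorbit x) f -> UCB R (Gorbit x) (f \o Gorbit_act g).
Proof.
move=> /UCB_orbitP[/bounded_funP[M fM] uf]; apply/UCB_orbitP; split=> [|e].
  by apply/bounded_funP; exists M => y; exact: fM.
move=> /uf[d d0 df]; exists d => // y z yz; apply: df => i /=.
by have [_ dg] := IsoP (\val g); rewrite [ltLHS]dg; exact: yz.
Qed.

Definition Gorbit_invariant (mu : (Gorbit x -> R) -> R) : Prop :=
  forall (f : Gorbit x -> R) (g : subgroup G),
    UCB R (Gorbit x) f -> mu (f \o Gorbit_act g) = mu f.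

End Orbits.

(* Main.v *)
Require Import Defs.
From mathcomp Require Import all_boot all_order all_algebra.
From mathcomp Require Import all_classical all_reals all_analysis.
From mathcomp Require Import ring lra.

(** For a tuple [x], the orbit map [g |-> g x] is equivariant and pulls bounded
    uniformly continuous functions on [G x] back to functions in [LUCB G],
    because the distance from [g x] to [h x] is the displacement of [x] under
    [g^-1 h].  A left-invariant mean on [LUCB G] therefore pushes forward to an
    invariant mean on each orbit ([skew_amenable_orbit_mean]).

    For the converse, the sets of group elements moving each point of a finite
    set by less than [d] form a neighbourhood basis of the identity
    ([nbhs1_small_displacement]), so the value of a left-uniformly continuous
    [f] at [g] depends, up to a small error, only on the point [g x] of an orbit
    of a long enough tuple [x].  To turn this into a function on the orbit,
    take the Lipschitz envelope (Pasch-Hausdorff regularisation)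
      [E(f)(y) = sup_k (f k - c * D (k x) y)],
    with [D] the sum of the coordinate distances.  It is bounded and
    [c]-Lipschitz, hence uniformly continuous; it commutes exactly with
    translations ([envelope_lmul]) since [G] acts by isometries; and its
    pullback to [G] converges uniformly to [f] as the tuple [x] and the slope
    [c] grow ([tuple_envelope_approx]).

    Let [nu_(x, c)] send [f] to the value at [E(f)] of an invariant mean on
    [G x].  These functionals are positive, normalised and left-invariant.
    They are not linear, since [E] is not, but the defect tends to [0] along
    the directed set of pairs [(x, c)].  The means on different orbits need
    not be compatible, so the net may diverge; its limit along an ultrafilter
    exists and is a left-invariant mean ([ultralimit_mean]). *)

Set Implicit Arguments.
Unset Strict Implicit.
Unset Printing Implicit Defensive.

Import Order.TTheory GRing.Theory Num.Theory.
Import numFieldNormedType.Exports.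

Local Open Scope classical_set_scope.
Local Open Scope ring_scope.

(** * Means and their ultralimits *)

Section MeanEstimates.
Context {R : realType} (Z : Type) (A : set (Z -> R)) (mu : (Z -> R) -> R).
Hypotheses (subA : bounded_subspace A) (mmu : mean A mu).

Lemma le_meanD (f g : Z -> R) (e : R) : A f -> A g ->
  (forall z, f z <= g z + e) -> mu f <= mu g + e.
Proof.
case: subA mmu => _ linA A1 [linmu posmu mu1] Af Ag fg.
have Age : A (fun z => e * 1 + g z) by exact: linA.
have := posmu _ (linA (-1) _ _ Af Age).
rewrite !linmu// mu1 mulr1 mulN1r addrC subr_ge0 (addrC (mu g)); apply => z.
by rewrite mulN1r addrC subr_ge0 addrC.
Qed.

Lemma mean_normB (f g : Z -> R) (e : R) : A f -> A g ->
  (forall z, `|f z - g z| <= e) -> `|mu f - mu g| <= e.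
Proof.
move=> Af Ag fg; rewrite ler_distlC lerBlDr.
by apply/andP; split; apply: le_meanD => // z;
  have := fg z; rewrite ler_distlC lerBlDr => /andP[].
Qed.

Lemma mean_norm_le (f : Z -> R) (M : R) : A f ->
  (forall z, `|f z| <= M) -> `|mu f| <= M.
Proof.
case: subA mmu => _ linA A1 [linmu _ mu1] Af fM.
have A0 : A (fun=> -1 * 1 + 1) by exact: linA.
have mu0 : mu (fun=> -1 * 1 + 1) = 0 by rewrite linmu// mu1 mulr1 addNr.
rewrite -[mu f]subr0 -mu0; apply: mean_normB => // z.
by rewrite mulr1 addNr subr0.
Qed.

End MeanEstimates.

Lemma bounded_ultra_cvg {R : realType} (I : Type) (U : set_system I)
    (u : I -> R) (M : R) : UltraFilter U -> (forall i, `|u i| <= M) ->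
  cvg (u i @[i --> U]).
Proof.
move=> UU uM; have PU : ProperFilter U := ultra_proper.
have uMM : (u i @[i --> U]) `[- M, M]%classic.
  by apply: (@filterE _ U) => i /=; rewrite in_itv/= -ler_norml.
have [l [_ ul]] := @segment_compact R (- M) M (u i @[i --> U]) _ uMM.
apply/cvg_ex; exists l => V lV.
have [//|UnV] := in_ultra_setVsetC (u @^-1` V) UU.
by have [z []] := ul (~` V) V UnV lV.
Qed.

(** Linearity is only asked in the limit, so that the functionals may be
    composed with a non-linear regularisation.  The final clause transfers
    to the limit any identity that holds along the whole family, such as
    invariance. *)
Lemma ultralimit_mean {R : realType} (Z : Type) (A : set (Z -> R)) (I : Type)
    (F : set_system I) (nu : I -> (Z -> R) -> R) : ProperFilter F ->
  (forall f, A f -> exists M, forall i, `|nu i f| <= M) ->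
  (forall a f g, A f -> A g -> forall e : R, 0 < e ->
    \forall i \near F,
      `|nu i (fun z => a * f z + g z) - (a * nu i f + nu i g)| <= e) ->
  (forall i f, A f -> (forall z, 0 <= f z) -> 0 <= nu i f) ->
  (forall i, nu i (fun=> 1) = 1) ->
  exists mu, mean A mu /\
    forall f g, (forall i, nu i f = nu i g) -> mu f = mu g.
Proof.
move=> PF bnu linnu posnu nu1.
have [U [UU FU]] := ultraFilterLemma PF.
have cvgnu f : A f -> cvg (nu i f @[i --> U]).
  by move=> /bnu[M fM]; exact: bounded_ultra_cvg fM.
exists (fun f => lim (nu i f @[i --> U])); split; last first.
  by move=> f g fg; congr (lim (_ @ U)); exact/funext.
split=> [a f g Af Ag|f Af f0|].
- apply: cvg_lim => //.
  rewrite -[X in _ --> X]add0r.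
  (* The defect of linearity tends to 0, and the linear part converges. *)
  pose lin i := a * nu i f + nu i g.
  rewrite (eq_cvg _ _ (fun i => esym (subrK (lin i) _))).
  apply: cvgD; last first.
    by apply: cvgD; [apply: cvgMl_tmp|]; exact: cvgnu.
  apply/cvgr0Pnorm_le => e e0; apply: FU; exact: linnu.
- apply: limr_ge; first exact: cvgnu.
  by apply: filterE => i; exact: posnu.
- apply: cvg_lim => //; rewrite (eq_cvg _ _ nu1).
  exact: cvg_cst.
Qed.

(** * The topology of a group of isometries *)

Section Displacement.
Context {R : realType} {X : metricType R} (G : groupClosed (Iso X)).

Lemma subgroup_eval_continuous (x : X) :
  continuous (fun g : subgroup G => \val g x).
Proof.
move=> g; apply: (@continuous_comp (subgroup G) (Iso X) X \val
  (fun f : Iso X => f x)); first exact: initial_continuous.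
exact: Iso_eval_continuous.
Qed.

Lemma mdist_subgroupVM (g h : subgroup G) (x : X) :
  mdist x (\val (g^-1 * h)%g x) = mdist (\val g x) (\val h x).
Proof.
have [_ dg] := IsoP (\val g).
by rewrite -dg -[X in mdist _ X]/(\val (g * (g^-1 * h))%g x) mulVKg.
Qed.

Definition small_displacement (p : seq X * R) : set (subgroup G) :=
  [set g : subgroup G | forall x, x \in p.1 -> mdist x (\val g x) < p.2].

(** The sets of small displacement generate a filter, and this filter converges
    to the identity pointwise on [X], hence in the topology of the group. *)
Lemma nbhs1_small_displacement (U : set (subgroup G)) : nbhs 1%g U ->
  exists (s : seq X) (d : R), 0 < d /\ small_displacement (s, d) `<=` U.
Proof.
pose F := filter_from [set p : seq X * R | 0 < p.2] small_displacement.
have FF : Filter F.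
  apply: filter_from_filter; first by exists ([::], 1) => /=.
  move=> [s d] [t e] /= d0 e0; exists (s ++ t, Num.min d e) => /=.
    by rewrite lt_min d0.
  move=> g /= gst; split=> x xs; have := gst x;
    by rewrite mem_cat xs ?orbT lt_min => /(_ isT)/andP[].
have F1 : (\val : subgroup G -> Iso X) @ F --> (1%g : Iso X).
  apply: Iso_cvg => x.
  apply/metricType_numDomainType.cvgrPdist_lt => e e0.
  by exists ([:: x], e) => //= g /(_ x); rewrite inE eqxx; exact.
case=> _ [[W oW <-] W1 WU].
have [[s d] /= d0 sW] : F (\val @^-1` W).
  by apply: F1; exact: open_nbhs_nbhs.
by exists s, d; split=> // g /sW; exact: WU.
Qed.

End Displacement.

(** * Orbit maps *)

Section OrbitMap.
Context {R : realType} {X : metricType R} (G : groupClosed (Iso X)).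
Context {n : nat} (x : {ptws 'I_n -> X}).

Definition orbit_map (g : subgroup G) : Gorbit G x :=
  exist _ (coord_act g x) (mem_set (ex_intro2 _ _ g I erefl)).

Lemma orbit_map_surj (y : Gorbit G x) : exists g, y = orbit_map g.
Proof.
case: y => y yP; have /set_mem[g _ gy] := yP.
by exists g; apply: val_inj; rewrite /= -gy.
Qed.

Lemma Gorbit_act_orbit_map g h :
  Gorbit_act g (orbit_map h) = orbit_map (g * h)%g.
Proof. exact: val_inj. Qed.

Lemma LUCB_orbit_map (f : Gorbit G x -> R) :
  UCB R (Gorbit G x) f -> LUCB R (subgroup G) (f \o orbit_map).
Proof.
move=> /UCB_orbitP[/Defs.bounded_funP[M fM] uf]; split.
  by apply/Defs.bounded_funP; exists M => g; exact: fM.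
move=> e /uf[d d0 df].
exists [set g : subgroup G | forall i, mdist (x i) (\val g (x i)) < d].
  apply: (@filter_forall (subgroup G) 'I_n
    (fun i (g : subgroup G) => mdist (x i) (\val g (x i)) < d) _
    (nbhs_filter _)) => i.
  have /metricType_numDomainType.cvgrPdist_lt/(_ _ d0) :=
    @subgroup_eval_continuous _ _ G (x i) 1%g.
  exact.
move=> g h ghd; apply/ltW/df => i.
by rewrite /= /coord_act -mdist_subgroupVM; exact: ghd.
Qed.

End OrbitMap.

Lemma skew_amenable_orbit_mean {R : realType} {X : metricType R}
    (G : groupClosed (Iso X)) (n : nat) (x : {ptws 'I_n -> X}) :
  skew_amenable R (subgroup G) ->
  exists mu : (Gorbit G x -> R) -> R,
    mean (UCB R (Gorbit G x)) mu /\ Gorbit_invariant mu.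
Proof.
move=> [mu [[linmu posmu mu1] invmu]].
exists (fun f => mu (f \o @orbit_map _ _ G _ x)); split.
  split=> [a f g uf ug|f uf f0|//].
    by rewrite -linmu//; exact: LUCB_orbit_map.
  by apply: posmu => [|g]; [exact: LUCB_orbit_map|exact: f0].
move=> f g uf; rewrite -(invmu _ g (LUCB_orbit_map uf)).
by congr mu; apply/funext => h /=; rewrite Gorbit_act_orbit_map.
Qed.

(** * Lipschitz envelopes *)

Section Envelope.
Context {R : realType} {X : metricType R} (G : groupClosed (Iso X)).

Section FixedTuple.
Context {n : nat}.
Implicit Types x y z : {ptws 'I_n -> X}.

(** The sum metric is uniformly equivalent to the maximum metric for each fixed
    length of the tuples. *)
Definition sum_dist x y : R := \sum_(i < n) mdist (x i) (y i).

Lemma sum_dist_ge0 x y : 0 <= sum_dist x y.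
Proof. by apply: sumr_ge0 => i _; exact: mdist_ge0. Qed.

Lemma sum_distxx x : sum_dist x x = 0.
Proof. by apply: big1 => i _; exact: mdistxx. Qed.

Lemma sum_dist_triangle x y z : sum_dist x z <= sum_dist x y + sum_dist y z.
Proof.
by rewrite -big_split; apply: ler_sum => i _; exact: metric_triangle.
Qed.

Lemma mdist_le_sum_dist x y i : mdist (x i) (y i) <= sum_dist x y.
Proof.
rewrite /sum_dist (bigD1 i)//= lerDl.
by apply: sumr_ge0 => j _; exact: mdist_ge0.
Qed.

Lemma sum_dist_act (g : subgroup G) x y :
  sum_dist (coord_act g x) (coord_act g y) = sum_dist x y.
Proof. by apply: eq_bigr => i _; have [_ ->] := IsoP (\val g). Qed.

(** The Pasch-Hausdorff regularisation of [f], seen on the orbit of [x]; letting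
    [y] range over all tuples keeps proofs of membership in the orbit out of the
    estimates. *)
Definition envelope (c : R) (f : subgroup G -> R) x y : R :=
  sup (range (fun k => f k - c * sum_dist (coord_act k x) y)).

Variables (c : R) (c0 : 0 <= c) (x : {ptws 'I_n -> X}).

Lemma envelope_le (f : subgroup G -> R) y (B : R) :
  (forall k, f k - c * sum_dist (coord_act k x) y <= B) ->
  envelope c f x y <= B.
Proof.
move=> fB; apply: ge_sup; last by move=> _ [k _ <-].
by exists (f 1%g - c * sum_dist (coord_act (1%g : subgroup G) x) y), 1%g.
Qed.

Lemma envelope_ge (f : subgroup G -> R) k y : bounded_fun f ->
  f k - c * sum_dist (coord_act k x) y <= envelope c f x y.
Proof.
move=> /Defs.bounded_funP[M fM]; apply: ub_le_sup; last by exists k.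
exists M => _ [h _ <-]; rewrite lerBlDr (le_trans (ler_norm _))//.
by rewrite (le_trans (fM h))// lerDl mulr_ge0// sum_dist_ge0.
Qed.

Lemma envelope_ge_orbit (f : subgroup G -> R) g : bounded_fun f ->
  f g <= envelope c f x (coord_act g x).
Proof.
by move=> /(envelope_ge g (coord_act g x)); rewrite sum_distxx mulr0 subr0.
Qed.

Lemma envelope_lipschitz (f : subgroup G -> R) y z : bounded_fun f ->
  envelope c f x y <= envelope c f x z + c * sum_dist y z.
Proof.
move=> bf; apply: envelope_le => k.
have fkz := envelope_ge k z bf.
have := ler_wpM2l c0 (sum_dist_triangle (coord_act k x) y z).
lra.
Qed.

(** Reindex the supremum by [k |-> g k]; the penalties do not change because [g]
    preserves [sum_dist]. *)
Lemma envelope_lmul (f : subgroup G -> R) g y :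
  envelope c (fun k => f (g * k)%g) x y = envelope c f x (coord_act g y).
Proof.
congr sup; apply/seteqP; split=> _ [k _ <-].
  by exists (g * k)%g => //; rewrite coord_actM sum_dist_act.
exists (g^-1 * k)%g => //.
by rewrite mulVKg -(sum_dist_act g) -coord_actM mulVKg.
Qed.

Definition orbit_envelope (f : subgroup G -> R) (u : Gorbit G x) : R :=
  envelope c f x (\val u).

Lemma orbit_envelope_norm_le (f : subgroup G -> R) (M : R) :
  (forall k, `|f k| <= M) -> forall u, `|orbit_envelope f u| <= M.
Proof.
move=> fM y; have bf : bounded_fun f by apply/Defs.bounded_funP; exists M.
have [g ->] := orbit_map_surj y.
rewrite ler_norml; apply/andP; split.
  apply: le_trans (envelope_ge_orbit g bf).
  by have := fM g; rewrite ler_norml => /andP[].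
apply: envelope_le => k; rewrite lerBlDr (le_trans (ler_norm _))//.
by rewrite (le_trans (fM k))// lerDl mulr_ge0// sum_dist_ge0.
Qed.

(** The modulus of continuity depends on the length [n] of the tuple because
    closeness on the orbit is measured coordinatewise; the summand [1] in [K]
    keeps it positive for empty tuples and for [c = 0]. *)
Lemma UCB_orbit_envelope (f : subgroup G -> R) :
  bounded_fun f -> UCB R (Gorbit G x) (orbit_envelope f).
Proof.
move=> bf; apply/UCB_orbitP; split.
  have /Defs.bounded_funP[M fM] := bf.
  by apply/Defs.bounded_funP; exists M; exact: orbit_envelope_norm_le.
move=> e e0; pose K := c * n%:R + 1.
have K0 : 0 < K by rewrite ltr_wpDl// mulr_ge0.
exists (e / K); first exact: divr_gt0.
move=> y z yz.
have lip (u v : Gorbit G x) :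
    (forall i, mdist (\val u i) (\val v i) < e / K) ->
    orbit_envelope f u - orbit_envelope f v < e.
  move=> uv; have uvn : sum_dist (\val u) (\val v) <= e / K *+ n.
    by rewrite -[n in _ *+ n]card_ord -sumr_const ler_sum// => i _; exact: ltW.
  rewrite ltrBlDl (le_lt_trans (envelope_lipschitz _ (\val v) bf))//.
  rewrite ltrD2l (le_lt_trans (ler_wpM2l c0 uvn))//.
  have -> : c * (e / K *+ n) = e * (c * n%:R) / K by rewrite -mulr_natl; ring.
  by rewrite ltr_pdivrMr// ltr_pM2l// ltrDl.
rewrite ltr_norml ltrNl opprB; apply/andP; split; last exact: lip.
by apply: lip => i; rewrite metric_sym.
Qed.

Lemma orbit_envelope_ge0 (f : subgroup G -> R) : bounded_fun f ->
  (forall k, 0 <= f k) -> forall u, 0 <= orbit_envelope f u.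
Proof.
move=> bf f0 y; have [g ->] := orbit_map_surj y.
exact: le_trans (f0 g) (envelope_ge_orbit g bf).
Qed.

Lemma orbit_envelope1 : orbit_envelope (fun=> 1) = fun=> 1.
Proof.
apply/funext => y; have [g ->] := orbit_map_surj y.
apply/eqP; rewrite eq_le; apply/andP; split.
  by apply: envelope_le => k; rewrite gerBl mulr_ge0// sum_dist_ge0.
exact/(envelope_ge_orbit g)/bounded_fun1.
Qed.

End FixedTuple.

Definition tuple_of (s : seq X) : {ptws 'I_(size s) -> X} := tnth (in_tuple s).

Arguments tuple_of : clear implicits.

(** A pair stands for the tuple of entries of the list and the slope of the
    envelope.  Lists are compared as sets, so that concatenation gives upper
    bounds. *)
Definition refinements (p : seq X * nat) : set (seq X * nat) :=
  [set q : seq X * nat | {subset p.1 <= q.1} /\ (p.2 <= q.2)%N].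

Definition refinement_filter : set_system (seq X * nat) :=
  filter_from setT refinements.

Lemma refinement_filter_proper : ProperFilter refinement_filter.
Proof.
apply: filter_from_proper; last by move=> p _; exists p; split.
apply: filter_from_filter; first by exists ([::], 0%N).
move=> [s m] [t l] _ _; exists (s ++ t, maxn m l) => // q [/= st].
rewrite geq_max => /andP[mq lq].
by split; split=> //= y ys; apply: st; rewrite mem_cat ys ?orbT.
Qed.

Definition tuple_envelope (q : seq X * nat) (f : subgroup G -> R) :
  Gorbit G (tuple_of q.1) -> R := orbit_envelope q.2%:R f.

Arguments tuple_envelope : clear implicits.

(** The envelope dominates [f].  Conversely, a competitor [k] in the supremum at
    [g x] either has [g^-1 k] of small displacement, and then [f k] exceeds
    [f g] by at most [e], or it moves some coordinate at distance at least [d]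
    from [g x]; in that case the penalty is at least [2 M], where [M] bounds
    [f], and lowers the competitor to at most [- M]. *)
Lemma tuple_envelope_approx (f : subgroup G -> R) (e : R) :
  LUCB R (subgroup G) f -> 0 < e -> \forall q \near refinement_filter, forall g,
    `|tuple_envelope q f (orbit_map (tuple_of q.1) g) - f g| <= e.
Proof.
move=> [bf uf] e0; have [U U1 fU] := uf _ e0.
have [s [d [d0 sU]]] := nbhs1_small_displacement U1.
have /Defs.bounded_funP[M fM] := bf.
exists (s, Num.Def.archi_bound (M *+ 2 / d)) => // -[t m] [/= st mM] g.
have fge : f g <= tuple_envelope (t, m) f (orbit_map (tuple_of t) g).
  exact: envelope_ge_orbit.
rewrite ger0_norm ?subr_ge0// lerBlDl.
apply: envelope_le => //= k.
have [near|far] := pselect (small_displacement (s, d) (g^-1 * k)%g).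
  have := fU _ _ (sU _ near); rewrite ler_distlC => /andP[_ fk].
  by rewrite lerBlDr (le_trans fk)// lerDl mulr_ge0// sum_dist_ge0.
have [y ys dy] : exists2 y, y \in s & d <= mdist (\val k y) (\val g y).
  apply: contrapT => nex; apply: far => y ys /=.
  rewrite mdist_subgroupVM metric_sym ltNge; apply/negP => dy.
  by apply: nex; exists y.
have /tnthP[i yi] : y \in in_tuple t by exact: st.
have dD : d <= sum_dist (coord_act k (tuple_of t)) (coord_act g (tuple_of t)).
  apply: le_trans (mdist_le_sum_dist _ _ i).
  by rewrite /coord_act /tuple_of -yi.
have M0 : 0 <= M := le_trans (normr_ge0 _) (fM g).
have cd : M *+ 2 <= m%:R * d.
  rewrite -ler_pdivrMr// -(ler_nat R) in mM *.
  by rewrite (le_trans _ mM)// ltW// archi_boundP// divr_ge0 ?mulrn_wge0// ltW.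
have := ler_wpM2l (ler0n _ m) dD.
have /ler_normlP[fk _] := fM k; have /ler_normlP[_ fg] := fM k.
have /ler_normlP[fg' _] := fM g.
lra.
Qed.

End Envelope.

Arguments tuple_of {R X} s.
Arguments tuple_envelope {R X G} q f u.

Lemma orbit_means_skew_amenable {R : realType} {X : metricType R}
    (G : groupClosed (Iso X)) :
  (forall (n : nat) (x : {ptws 'I_n -> X}),
    exists mu : (Gorbit G x -> R) -> R,
      mean (UCB R (Gorbit G x)) mu /\ Gorbit_invariant mu) ->
  skew_amenable R (subgroup G).
Proof.
move=> H.
pose mu n (x : {ptws 'I_n -> X}) := sval (cid (H n x)).
have muP n (x : {ptws 'I_n -> X}) :
    mean (UCB R (Gorbit G x)) (mu n x) /\ Gorbit_invariant (mu n x).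
  by rewrite /mu; case: cid.
pose nu (q : seq X * nat) (f : subgroup G -> R) :=
  mu _ (tuple_of q.1) (tuple_envelope q f).
have UCB_env q f : LUCB R (subgroup G) f -> UCB R _ (tuple_envelope q f).
  by move=> [bf _]; exact: UCB_orbit_envelope.
have [|||q f Af f0|q|m [mm inv_m]] :=
  @ultralimit_mean R _ (LUCB R (subgroup G)) _ (@refinement_filter R X) nu.
- exact: refinement_filter_proper.
- move=> f Af; have [/Defs.bounded_funP[M fM] _] := Af; exists M => q.
  apply: mean_norm_le (UCB_subspace _) (muP _ _).1 _ _ (UCB_env _ _ Af) _.
  exact: orbit_envelope_norm_le.
- move=> a f g Af Ag e e0.
  have Afg : LUCB R (subgroup G) (fun z => a * f z + g z).
    by case: (LUCB_subspace (R := R) (subgroup G)) => _ + _; exact.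
  have a1 : 0 < `|a| + 2 by rewrite ltr_pwDr.
  pose d := e / (`|a| + 2).
  have d0 : 0 < d by exact: divr_gt0.
  have PF := @refinement_filter_proper R X.
  apply: filterS3 (tuple_envelope_approx Af d0) (tuple_envelope_approx Ag d0)
    (tuple_envelope_approx Afg d0) => q df dg dfg.
  have [[linmu _ _] _] := muP _ (tuple_of q.1).
  rewrite /nu -linmu; try exact: UCB_env.
  apply: mean_normB (UCB_subspace _) (muP _ _).1 _ _ _ (UCB_env _ _ Afg) _ _.
    have [_ linUCB _] := @UCB_subspace R (Gorbit G (tuple_of q.1)).
    by apply: linUCB; exact: UCB_env.
  move=> y; have [h ->] := orbit_map_surj y.
  move: (dfg h) (df h) (dg h).
  (* Each of the three envelopes is within [d] of its function at [h], and
     [d] is chosen to make the errors add up to [e]. *)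
  set Efg := tuple_envelope q _ _; set Ef := tuple_envelope q f _.
  set Eg := tuple_envelope q g _ => dEfg dEf dEg.
  have -> : Efg - (a * Ef + Eg) =
    (Efg - (a * f h + g h)) - a * (Ef - f h) - (Eg - g h) by ring.
  have -> : e = d + `|a| * d + d by rewrite /d; field; rewrite gt_eqF.
  rewrite (le_trans (ler_normB _ _))// lerD//.
  rewrite (le_trans (ler_normB _ _))// lerD//.
  by rewrite normrM ler_wpM2l.
- have [[_ posmu _] _] := muP _ (tuple_of q.1).
  by apply: posmu; [exact: UCB_env|apply: orbit_envelope_ge0 => //; case: Af].
- have [[_ _ mu1] _] := muP _ (tuple_of q.1).
  by rewrite /nu /tuple_envelope orbit_envelope1.
- exists m; split=> // f g Af; apply: inv_m => q.
  rewrite /nu; have [_ inv] := muP _ (tuple_of q.1).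
  rewrite -(inv _ g (UCB_env _ _ Af)); congr (mu _ _ _).
  by apply/funext => y /=; exact: envelope_lmul.
Qed.

Theorem proposition3p11 (R : realType) (X : metricType R)
    (G : groupClosed (Iso X)) :
  skew_amenable R (subgroup G) <->
  forall (n : nat) (x : {ptws 'I_n -> X}),
    exists mu : (Gorbit G x -> R) -> R,
      mean (UCB R (Gorbit G x)) mu /\ Gorbit_invariant mu.
Proof.
split=> [sG n x|]; first exact: skew_amenable_orbit_mean.
exact: orbit_means_skew_amenable.
Qed.
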